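(* In HoTT extended with the Law of Excluded Middle (LEM), $(V,\in)\models\mathbf{CZF}+\mathbf{IZF}$; that is, for every axiom $\chi$ of $\mathbf{CZF}$ or of $\mathbf{IZF}$ the type $[\![\chi]\!]_V$ (universally quantified over its free variables) is inhabited.
   Context: Work in HoTT: Martin-Löf type theory with the univalence axiom and higher inductive types, with two type universes $U:U'$. $\mathrm{isProp}(P):\equiv\prod_{x,y:P}x=y$, $\mathrm{Prop}_{U'}:\equiv\sum_{P:U'}\mathrm{isProp}(P)$. The symbols $\exists,\vee$ denote the propositional truncations of $\Sigma,+$. LEM: $\prod_{P:U}(\mathrm{isProp}(P)\to(P+\neg P))$. The cumulative hierarchy $V:U'$ is the higher inductive type with constructors: $\mathsf{set}:\prod_{A:U}(A\to V)\to V$; for all $A,B:U$, $f:A\to V$, $g:B\to V$, a path $\mathsf{set}(A,f)=\mathsf{set}(B,g)$ whenever $(\forall(a:A).\exists(b:B).f(a)=g(b))\wedge(\forall(b:B).\exists(a:A).f(a)=g(b))$; and a $0$-truncation constructor (so $V$ is an h-set). Membership is defined by $x\in\mathsf{set}(A,f):\equiv\exists(a:A).x=f(a)$, a proposition in $U'$. Formulas $\phi$ of the first-order language $\{\in\}$ of set theory are translated into predicates $[\![\phi]\!]_V:V^k\to\mathrm{Prop}_{U'}$ ($k$ the number of free variables) by induction: $x=y$ as the identity type of $V$, $x\in y$ as membership above, $\neg\phi$ as $\phi\to\mathbf 0$, $\to,\wedge,\vee$ as the corresponding operations on propositions ($\vee$ truncated), $\exists x$ and $\forall x$ as the truncated $\exists(x:V)$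 and $\prod_{x:V}$. $(V,\in)\models\phi$ means that $\forall(t_1,\dots,t_k:V).[\![\phi]\!]_V(t_1,\dots,t_k)$ is inhabited. Axioms (the formulas in the schemes may have any number of other free variables, but the variable for the set asserted to exist is not free in them): - Infinity: $\exists a\,\mathrm{Ind}(a)$; Strong Infinity: $\exists a(\mathrm{Ind}(a)\wedge\forall b(\mathrm{Ind}(b)\Rightarrow a\subseteq b))$, where $\mathrm{Ind}(x):=(\emptyset\in x\wedge\forall y\in x\; y\cup\{y\}\in x)$. - Powerset: $\forall v\exists p\forall x(x\in p\iff x\subseteq v)$. - Separation: $\forall a\exists w\forall x(x\in w\iff x\in a\wedge\phi(x))$ for every $\phi$; $\Delta_0$-Separation: the same for $\Delta_0$ formulas $\phi$ (all quantifiers bounded). - $\in$-induction: $\bigl(\forall a((\forall y\in a\,\phi(y))\Rightarrow\phi(a))\bigr)\Rightarrow\forall a\,\phi(a)$. - Collection: $\forall a(\forall x\in a\,\exists y\,\theta(x,y)\Rightarrow\exists b\,\forall x\in a\,\exists y\in b\,\theta(x,y))$, $b$ not free in $\theta$. - Strong Collection: $\forall a(\forall x\in a\,\exists y\,\phi(x,y)\Rightarrow\exists b(\forall x\in a\,\exists y\in b\,\phi(x,y)\wedge\forall y\in b\,\exists x\in a\,\phi(x,y)))$. - Subset Collection: $\forall a\forall b\,\exists c\,\forall u(\forall x\in a\,\exists y\in b\,\psi(x,y,u)\Rightarrow\exists d\in c(\forall x\in a\,\exists y\in d\,\psi(x,y,u)\wedge\forall y\in d\,\exists x\in a\,\psi(x,y,u)))$.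 $\mathbf{IZF}$: Extensionality, Empty Set, Pairing, Union, Infinity, Powerset, Separation, $\in$-induction, Collection. $\mathbf{CZF}$: Extensionality, Empty Set, Pairing, Union, Strong Infinity, $\Delta_0$-Separation, $\in$-induction, Strong Collection, Subset Collection.
   Formalization: LEM is assumed for propositions of both universes U and U', not only for P:U; with LEM for U alone the claim fails, since formulas are interpreted in Prop_{U'} and a Kripke model over {0<1} refutes full Separation. *)

(* Defs.v *)
From Stdlib Require Import Fin.

Set Implicit Arguments.
Unset Strict Implicit.

(* HoTT is set up as the inner level of a two-level type theory whose outer
   level is Rocq.  A HoTT type is a Rocq type with a fibrancy structure, [eq] is
   judgmental equality, and [Id] is the HoTT identity type; [Id], [Zero], [Sum],
   [Nat] and the truncation eliminate into HoTT types only, while Pi, Sigma and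
   the unit type are those of Rocq.
   Rocq's own inductive identity type could not serve as [Id]: it is equivalent
   to [eq], which lives in [Prop] and eliminates into every [Type], so that
   univalence for a universe above another one would make sets of large types
   small, which is contradictory together with excluded middle. *)

Record Ty (Fib : Type -> Type) : Type := mkTy { El :> Type; El_fib : Fib El }.

Record TypeTheory : Type := {
  Fib : Type -> Type;

  Pi_fib : forall (A : Ty Fib) (B : A -> Ty Fib), Fib (forall x : A, B x);
  Sig_fib : forall (A : Ty Fib) (B : A -> Ty Fib), Fib {x : A & B x};
  Unit_fib : Fib unit;

  Zero : Ty Fib;
  Zero_rect : forall (P : Zero -> Ty Fib) (z : Zero), P z;

  Sum : Ty Fib -> Ty Fib -> Ty Fib;
  inl : forall A B : Ty Fib, A -> Sum A B;
  inr : forall A B : Ty Fib, B -> Sum A B;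
  Sum_rect : forall (A B : Ty Fib) (P : Sum A B -> Ty Fib),
      (forall a, P (inl B a)) -> (forall b, P (inr A b)) -> forall s, P s;
  Sum_rect_inl : forall A B P f g a, @Sum_rect A B P f g (inl B a) = f a;
  Sum_rect_inr : forall A B P f g b, @Sum_rect A B P f g (inr A b) = g b;

  Nat : Ty Fib;
  zero : Nat;
  succ : Nat -> Nat;
  Nat_rect : forall P : Nat -> Ty Fib,
      P zero -> (forall n, P n -> P (succ n)) -> forall n, P n;
  Nat_rect_zero : forall P c h, @Nat_rect P c h zero = c;
  Nat_rect_succ : forall P c h n,
      @Nat_rect P c h (succ n) = h n (@Nat_rect P c h n);

  Id : forall A : Ty Fib, A -> A -> Ty Fib;
  refl : forall (A : Ty Fib) (a : A), Id a a;
  J : forall (A : Ty Fib) (a : A) (P : forall x : A, Id a x -> Ty Fib),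
      P a (refl a) -> forall (x : A) (p : Id a x), P x p;
  J_refl : forall A a P d, @J A a P d a (refl a) = d
}.

Section Basics.

Context {T : TypeTheory}.
Notation Ty := (Ty (Fib T)).

Definition Pi (A : Ty) (B : A -> Ty) : Ty := mkTy (Pi_fib B).
Definition Sig (A : Ty) (B : A -> Ty) : Ty := mkTy (Sig_fib B).
Definition Unit : Ty := mkTy (Unit_fib T).
Definition Arrow (A B : Ty) : Ty := Pi (fun _ : A => B).
Definition Times (A B : Ty) : Ty := Sig (fun _ : A => B).
Definition Neg (A : Ty) : Ty := Arrow A (Zero T).

Definition isProp (A : Ty) : Ty := Pi (fun x : A => Pi (fun y : A => Id x y)).
Definition isSet (A : Ty) : Ty :=
  Pi (fun x : A => Pi (fun y : A => isProp (Id x y))).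
Definition isContr (A : Ty) : Ty :=
  Sig (fun c : A => Pi (fun x : A => Id c x)).

Definition isEquiv (A B : Ty) (f : A -> B) : Ty :=
  Pi (fun b : B => isContr (Sig (fun a : A => Id (f a) b))).
Definition Equiv (A B : Ty) : Ty :=
  Sig (fun f : Arrow A B => isEquiv f).

Definition transport (A : Ty) (P : A -> Ty) (x y : A) (p : Id x y) : P x -> P y :=
  J (P := fun y _ => Arrow (P x) (P y)) (fun u => u) p.

Definition PathOver (A : Ty) (P : A -> Ty) (x y : A) (p : Id x y)
    (u : P x) (v : P y) : Ty :=
  Id (transport (P := P) p u) v.

Definition inv (A : Ty) (x y : A) (p : Id x y) : Id y x :=
  J (P := fun y _ => Id y x) (refl x) p.

Definition concat (A : Ty) (x y z : A) (p : Id x y) (q : Id y z) : Id x z :=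
  J (P := fun z _ => Id x z) p q.

Definition ap (A B : Ty) (f : A -> B) (x y : A) (p : Id x y) : Id (f x) (f y) :=
  J (P := fun y _ => Id (f x) (f y)) (refl (f x)) p.

Lemma concat_inv_l (A : Ty) (x y : A) (p : Id x y) : Id (concat (inv p) p) (refl y).
Proof.
  refine (J (P := fun y p => Id (concat (inv p) p) (refl y)) _ p).
  unfold concat, inv; rewrite !J_refl; apply refl.
Defined.

Lemma idequiv_isEquiv (A : Ty) : isEquiv (fun x : A => x).
Proof.
  intro b.
  exists (existT (fun a : A => Id a b) b (refl b)).
  intros [a p].
  assert (H : Pi (fun c : A => Pi (fun q : Id a c =>
     Id (A := Sig (fun a : A => Id a c)) (existT _ c (refl c)) (existT _ a q)))).
  { intros c q.
    refine (J (P := fun c q => Id (A := Sig (fun a : A => Id a c))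
              (existT _ c (refl c)) (existT _ a q)) _ q).
    apply refl. }
  exact (H b p).
Defined.

Definition idequiv (A : Ty) : Equiv A A :=
  existT (fun f : Arrow A A => isEquiv f) (fun x => x) (@idequiv_isEquiv A).

(* Weakly constant endomaps of the identity types make a type a set. *)
Lemma isSet_of_const (A : Ty) (f : forall x y : A, Id x y -> Id x y)
    (fc : forall x y (p q : Id x y), Id (f x y p) (f x y q)) : isSet A.
Proof.
  intros x y p q.
  assert (H : forall r : Id x y, Id r (concat (inv (f x x (refl x))) (f x y r))).
  { intro r.
    refine (J (P := fun y r => Id r (concat (inv (f x x (refl x))) (f x y r))) _ r).
    apply inv, concat_inv_l. }
  refine (concat (H p) (concat _ (inv (H q)))).
  exact (ap (fun r => concat (inv (f x x (refl x))) r) (fc x y p q)).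
Defined.

Lemma isSet_of_isProp (A : Ty) (h : isProp A) : isSet A.
Proof.
  apply isSet_of_const with (f := fun x y _ => h x y).
  intros; apply refl.
Defined.

Lemma Sig_path (A : Ty) (B : A -> Ty) (hB : forall x, isProp (B x)) (u v : Sig B) :
  Id (projT1 u) (projT1 v) -> Id u v.
Proof.
  destruct u as [a b], v as [a' b']; cbn; intro p.
  assert (H : Pi (fun b' : B a' => Id (A := Sig B) (existT _ a b) (existT _ a' b'))).
  { refine (J (P := fun a' _ => Pi (fun b' : B a' =>
        Id (A := Sig B) (existT _ a b) (existT _ a' b'))) _ p).
    intro c.
    exact (ap (B := Sig B) (fun z => existT (fun x : A => B x) a z) (hB a b c)). }
  exact (H b').
Defined.

Lemma isEquiv_of_iff (A B : Ty) (hA : isProp A) (hB : isProp B)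
    (f : A -> B) (g : B -> A) : isEquiv f.
Proof.
  intro b.
  exists (existT (fun a : A => Id (f a) b) (g b) (hB (f (g b)) b)).
  intros [a p]; apply Sig_path.
  - intro x; exact (@isSet_of_isProp B hB (f x) b).
  - apply hA.
Defined.

End Basics.

Record Truncation (T : TypeTheory) : Type := {
  Trunc : Ty (Fib T) -> Ty (Fib T);
  tr : forall A : Ty (Fib T), A -> Trunc A;
  Trunc_isProp : forall A : Ty (Fib T), isProp (Trunc A);
  Trunc_rect : forall (A : Ty (Fib T)) (P : Trunc A -> Ty (Fib T)),
      (forall z, isProp (P z)) -> (forall a, P (tr a)) -> forall z, P z;
  Trunc_rect_tr : forall A P h d a, @Trunc_rect A P h d (tr a) = d a
}.

Record PreUniverse (T : TypeTheory) : Type := {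
  Code :> Ty (Fib T);
  dec : Code -> Ty (Fib T)
}.

Record In (T : TypeTheory) (X : PreUniverse T) (A : Ty (Fib T)) : Type := mkIn {
  code : X;
  dec_code : dec code = A
}.

Definition idtoeqv (T : TypeTheory) (X : PreUniverse T) (a b : X) :
    Id a b -> Equiv (dec a) (dec b) :=
  fun p => J (P := fun b _ => Equiv (dec a) (dec b)) (idequiv (dec a)) p.

Record Universe (T : TypeTheory) (tru : Truncation T) : Type := {
  preU :> PreUniverse T;
  In_Pi : forall (A : Ty (Fib T)) (B : A -> Ty (Fib T)),
      In preU A -> (forall x, In preU (B x)) -> In preU (Pi B);
  In_Sig : forall (A : Ty (Fib T)) (B : A -> Ty (Fib T)),
      In preU A -> (forall x, In preU (B x)) -> In preU (Sig B);
  In_Unit : In preU Unit;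
  In_Zero : In preU (Zero T);
  In_Sum : forall A B : Ty (Fib T), In preU A -> In preU B -> In preU (Sum A B);
  In_Nat : In preU (Nat T);
  In_Id : forall (A : Ty (Fib T)) (x y : A), In preU A -> In preU (Id x y);
  In_Trunc : forall A : Ty (Fib T), In preU A -> In preU (Trunc tru A);
  univalence : forall a b : preU, isEquiv (fun p : Id a b => idtoeqv p)
}.

Arguments univalence {T tru} u a b _.

(* Function extensionality, in the form needed for propositions, and the fact
   that the propositions of a universe form a set, both from univalence. *)
Section Univalence.

Context {T : TypeTheory} {tru : Truncation T} (X : Universe tru).
Notation Ty := (Ty (Fib T)).

Lemma isEquiv_postcomp (A B : Ty) (iA : In X A) (iB : In X B) (e : Equiv A B) (C : Ty) :
  isEquiv (A := Arrow C A) (B := Arrow C B) (fun h x => projT1 e (h x)).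
Proof.
  destruct iA as [a <-], iB as [b <-].
  destruct (univalence X a b e) as [[p q] _]; cbn in p, q.
  refine (transport (P := fun e : Equiv (dec a) (dec b) =>
     isEquiv (A := Arrow C (dec a)) (B := Arrow C (dec b))
             (fun h x => projT1 e (h x))) q _).
  refine (J (P := fun b p => isEquiv (A := Arrow C (dec a)) (B := Arrow C (dec b))
             (fun h x => projT1 (idtoeqv p) (h x))) _ p).
  unfold idtoeqv; rewrite J_refl; cbn.
  exact (@idequiv_isEquiv _ (Arrow C (dec a))).
Defined.

Lemma isContr_Pi (A : Ty) (B : A -> Ty) (iA : In X A) (iB : forall x, In X (B x))
    (h : forall x, isContr (B x)) : isContr (Pi B).
Proof.
  assert (e : isEquiv (A := Sig B) (B := A) (fun u => projT1 u)).
  { intro a.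
    exists (existT (fun u : Sig B => Id (projT1 u) a)
              (existT (fun x => El (B x)) a (projT1 (h a))) (refl a)).
    intros [[x b] p]; cbn in p.
    assert (K : Pi (fun y : A => Pi (fun q : Id x y =>
       Id (A := Sig (fun u : Sig B => Id (projT1 u) y))
          (existT _ (existT _ y (projT1 (h y))) (refl y))
          (existT _ (existT _ x b) q)))).
    { intros y q.
      refine (J (P := fun y q => Id (A := Sig (fun u : Sig B => Id (projT1 u) y))
          (existT _ (existT _ y (projT1 (h y))) (refl y))
          (existT _ (existT _ x b) q)) _ q).
      exact (ap (B := Sig (fun u : Sig B => Id (projT1 u) x))
               (fun c : B x => existT (fun u : Sig B => Id (projT1 u) x)
                  (existT (fun x => El (B x)) x c) (refl x))
               (projT2 (h x) b)). }
    exact (K a p). }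
  pose proof (@isEquiv_postcomp (Sig B) A (In_Sig iA iB) iA
    (existT (fun f : Arrow (Sig B) A => El (isEquiv f)) _ e) A (fun x => x)) as c.
  cbn in c.
  destruct c as [c hc].
  pose (r := fun w : Sig (A := Arrow A (Sig B))
                 (fun k => Id (A := Arrow A A) (fun x => projT1 (k x)) (fun x => x)) =>
    J (P := fun (g : Arrow A A) _ => Pi (fun x => B (g x)))
      (fun x => projT2 (projT1 w x)) (projT2 w)).
  exists (r c); intro f.
  pose (w := existT (fun k : Arrow A (Sig B) =>
                El (Id (A := Arrow A A) (fun x => projT1 (k x)) (fun x => x)))
        (fun x => existT (fun x => El (B x)) x (f x))
        (refl (A := Arrow A A) (fun x => x))).
  assert (rw : r w = f).
  { exact (J_refl (P := fun (g : Arrow A A) _ => Pi (fun x => B (g x))) f). }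
  rewrite <- rw.
  exact (ap (B := Pi B) r (hc w)).
Defined.

Lemma isProp_Pi (A : Ty) (B : A -> Ty) (iA : In X A) (iB : forall x, In X (B x))
    (h : forall x, isProp (B x)) : isProp (Pi B).
Proof.
  intros f g.
  destruct (isContr_Pi iA iB) as [c hc].
  - intro x; exists (f x); apply h.
  - exact (concat (inv (hc f)) (hc g)).
Defined.

Lemma isProp_isProp (A : Ty) (iA : In X A) : isProp (isProp A).
Proof.
  intros h k.
  assert (H : isProp (isProp A)); [|apply H].
  apply isProp_Pi; [assumption| |].
  - intro x; apply In_Pi; [assumption|]; intro y; apply In_Id; assumption.
  - intro x; apply isProp_Pi; [assumption| |].
    + intro y; apply In_Id; assumption.
    + intro y; exact (@isSet_of_isProp T A h x y).
Defined.

Definition PropU : Ty := Sig (fun c : X => isProp (dec c)).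

Lemma propext (P Q : PropU) :
  (dec (projT1 P) -> dec (projT1 Q)) -> (dec (projT1 Q) -> dec (projT1 P)) -> Id P Q.
Proof.
  intros f g; apply Sig_path.
  - intro c; apply isProp_isProp; exact (mkIn eq_refl).
  - destruct (univalence X (projT1 P) (projT1 Q)
      
      (existT (fun h : Arrow (dec (projT1 P)) (dec (projT1 Q)) => El (isEquiv h)) f
         (@isEquiv_of_iff _ _ _ (projT2 P) (projT2 Q) f g))) as [[p _] _].
    exact p.
Defined.

Lemma isSet_PropU : isSet PropU.
Proof.
  assert (In_dec : forall c : X, In X (dec c)) by (intro c; exact (mkIn eq_refl)).
  pose (R := fun P Q : PropU => Times (Arrow (dec (projT1 P)) (dec (projT1 Q)))
                                      (Arrow (dec (projT1 Q)) (dec (projT1 P)))).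
  assert (hR : forall P Q, isProp (R P Q)).
  { intros P Q u v; apply Sig_path.
    - intros _; apply isProp_Pi; auto; intros _; exact (projT2 P).
    - apply isProp_Pi; auto; intros _; exact (projT2 Q). }
  pose (d := fun (P Q : PropU) (p : Id P Q) =>
    J (P := fun Q _ => R P Q) (existT _ (fun x => x) (fun x => x) : R P P) p).
  apply isSet_of_const with
    (f := fun P Q p => propext (projT1 (d P Q p)) (projT2 (d P Q p))).
  intros P Q p q.
  exact (ap (A := R P Q) (fun u => propext (projT1 u) (projT2 u))
            (hR P Q (d P Q p) (d P Q q))).
Defined.

End Univalence.

Record HoTT : Type := {
  theory :> TypeTheory;
  trunc : Truncation theory;
  U : Universe trunc;
  U' : Universe trunc;
  In_U : In U' U;
  In_cumul : forall a : U, In U' (dec a)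
}.

Section Hierarchy.

Context (H : HoTT).
Notation Ty := (Ty (Fib H)).

(* Excluded middle at [U] does not decide the propositions of [U'], where formulas
   are interpreted; read with typical ambiguity it is available at both. *)
Definition LEM (X : Universe (trunc H)) : Ty :=
  Pi (fun P : X => Arrow (isProp (dec P)) (Sum (dec P) (Neg (dec P)))).

Definition Exists (A : Ty) (B : A -> Ty) : Ty := Trunc (trunc H) (Sig B).
Definition Or (A B : Ty) : Ty := Trunc (trunc H) (Sum A B).

Definition bisim (V A B : Ty) (f : A -> V) (g : B -> V) : Ty :=
  Times (Pi (fun a : A => Exists (fun b : B => Id (f a) (g b))))
        (Pi (fun b : B => Exists (fun a : A => Id (f a) (g b)))).

(* [V_isSet] is the 0-truncation constructor; since the motive of [V_ind] is a
   family of sets, the computation rule on [set_path] holds automatically. *)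
Record CumulativeHierarchy : Type := {
  V :> Ty;
  In_V : In (U' H) V;
  set : forall A : U H, (dec A -> V) -> V;
  set_path : forall (A B : U H) (f : dec A -> V) (g : dec B -> V),
      bisim f g -> Id (set f) (set g);
  V_isSet : isSet V;
  V_ind : forall (P : V -> Ty) (Pset : forall v, isSet (P v))
      (h : forall (A : U H) (f : dec A -> V), (forall a, P (f a)) -> P (set f))
      (hpath : forall (A B : U H) (f : dec A -> V) (g : dec B -> V)
          (w : bisim f g) (hf : forall a, P (f a)) (hg : forall b, P (g b)),
          (forall a, Exists (fun b : dec B => Exists (fun p : Id (f a) (g b) =>
             PathOver (P := P) p (hf a) (hg b)))) ->
          (forall b, Exists (fun a : dec A => Exists (fun p : Id (f a) (g b) =>
             PathOver (P := P) p (hf a) (hg b)))) ->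
          PathOver (P := P) (set_path w) (h A f hf) (h B g hg)),
      forall v, P v;
  V_ind_set : forall P Pset h hpath (A : U H) (f : dec A -> V),
      @V_ind P Pset h hpath (set f) =
      h A f (fun a => @V_ind P Pset h hpath (f a))
}.

End Hierarchy.

Section Membership.

Context {H : HoTT} (V : CumulativeHierarchy H).
Notation Ty := (Ty (Fib H)).

Lemma In_mem_set (x : V) (A : U H) (f : dec A -> V) :
  In (U' H) (Exists (fun a : dec A => Id x (f a))).
Proof.
  apply In_Trunc, In_Sig; [apply In_cumul|].
  intro a; apply In_Id, In_V.
Defined.

Lemma isProp_mem_set (x : V) (A : U H) (f : dec A -> V) :
  isProp (dec (code (In_mem_set x f))).
Proof.
  rewrite dec_code; apply Trunc_isProp.
Defined.

Definition mem_set_prop (x : V) (A : U H) (f : dec A -> V) : PropU (U' H) :=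
  existT (fun c : U' H => El (isProp (dec c)))
    (code (In_mem_set x f)) (@isProp_mem_set x A f).

Lemma mem_set_prop_path (x : V) (A B : U H) (f : dec A -> V) (g : dec B -> V)
    (w : bisim f g) : Id (mem_set_prop x f) (mem_set_prop x g).
Proof.
  destruct w as [wf wg].
  apply propext; cbn; rewrite !dec_code; intro z; revert z;
    apply Trunc_rect; try (intro; apply Trunc_isProp).
  - intros [a p].
    generalize (wf a); apply Trunc_rect; [intro; apply Trunc_isProp|].
    intros [b q]; apply tr; exists b; exact (concat p q).
  - intros [b p].
    generalize (wg b); apply Trunc_rect; [intro; apply Trunc_isProp|].
    intros [a q]; apply tr; exists a; exact (concat p (inv q)).
Defined.

Lemma PathOver_const (A B : Ty) (x y : A) (p : Id x y) (u v : B) :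
  Id u v -> PathOver (P := fun _ => B) p u v.
Proof.
  intro q.
  refine (J (P := fun y p => PathOver (P := fun _ => B) (y := y) p u v) _ p).
  unfold PathOver, transport; rewrite J_refl; exact q.
Defined.

Definition mem_prop (x : V) : V -> PropU (U' H) :=
  V_ind (c := V) (P := fun _ => PropU (U' H))
    (fun _ => @isSet_PropU _ _ (U' H))
    (h := fun A f _ => mem_set_prop x f)
    (fun A B f g w _ _ _ _ => PathOver_const (set_path w) (mem_set_prop_path x w)).

Definition mem (x y : V) : Ty := dec (projT1 (mem_prop x y)).

Lemma mem_set (x : V) (A : U H) (f : dec A -> V) :
  mem x (set f) = Exists (fun a : dec A => Id x (f a)).
Proof.
  unfold mem, mem_prop; rewrite V_ind_set; apply dec_code.
Defined.

End Membership.

(* [formula n]: formulas of the language of set theory with free variables among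
   n de Bruijn indices; a quantifier binds index 0. *)
Inductive formula : nat -> Type :=
| fEq n (i j : Fin.t n) : formula n
| fMem n (i j : Fin.t n) : formula n
| fNot n (p : formula n) : formula n
| fImp n (p q : formula n) : formula n
| fAnd n (p q : formula n) : formula n
| fOr n (p q : formula n) : formula n
| fEx n (p : formula (S n)) : formula n
| fAll n (p : formula (S n)) : formula n.

Section Interpretation.

Context {H : HoTT} (V : CumulativeHierarchy H).
Notation Ty := (Ty (Fib H)).

Fixpoint power (n : nat) : Ty :=
  match n with
  | O => Unit
  | S n => Times V (power n)
  end.

Fixpoint lookup n (i : Fin.t n) : power n -> V :=
  match i in Fin.t n return power n -> V with
  | F1 => fun t => projT1 t
  | FS i => fun t => lookup i (projT2 t)
  end.

Definition push n (x : V) (t : power n) : power (S n) :=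
  existT (fun _ : V => El (power n)) x t.

Fixpoint interp n (p : formula n) : power n -> Ty :=
  match p in formula n return power n -> Ty with
  | fEq i j => fun t => Id (lookup i t) (lookup j t)
  | fMem i j => fun t => mem (lookup i t) (lookup j t)
  | fNot p => fun t => Neg (interp p t)
  | fImp p q => fun t => Arrow (interp p t) (interp q t)
  | fAnd p q => fun t => Times (interp p t) (interp q t)
  | fOr p q => fun t => Or (interp p t) (interp q t)
  | fEx p => fun t => Exists (fun x : V => interp p (push x t))
  | fAll p => fun t => Pi (fun x : V => interp p (push x t))
  end.

Lemma In_power n : In (U' H) (power n).
Proof.
  induction n as [|n IH]; [apply In_Unit|].
  apply In_Sig; [apply In_V | intros _; exact IH].
Defined.

Lemma In_interp n (p : formula n) (t : power n) : In (U' H) (interp p t).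
Proof.
  revert t; induction p; intro t; cbn [interp].
  - apply In_Id, In_V.
  - exact (mkIn eq_refl).
  - apply In_Pi; [auto | intros _; apply In_Zero].
  - apply In_Pi; auto.
  - apply In_Sig; auto.
  - apply In_Trunc, In_Sum; auto.
  - apply In_Trunc, In_Sig; [apply In_V | auto].
  - apply In_Pi; [apply In_V | auto].
Defined.

Lemma isProp_interp n (p : formula n) (t : power n) : isProp (interp p t).
Proof.
  revert t; induction p; intro t; cbn [interp].
  - exact (@V_isSet H V (lookup i t) (lookup j t)).
  - exact (projT2 (mem_prop (lookup i t) (lookup j t))).
  - apply (@isProp_Pi _ _ (U' H)).
    + apply In_interp.
    + intros _; apply In_Zero.
    + intros _ z; exact (@Zero_rect _ (fun z => Pi (fun z' => Id z z')) z).
  - apply (@isProp_Pi _ _ (U' H)); intros; [apply In_interp .. | apply IHp2].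
  - intros u v; apply Sig_path; [intros _; apply IHp2 | apply IHp1].
  - apply Trunc_isProp.
  - apply Trunc_isProp.
  - apply (@isProp_Pi _ _ (U' H)); [apply In_V | |]; intros; [apply In_interp | apply IHp].
Defined.

Definition models n (p : formula n) : Ty := Pi (fun t : power n => interp p t).

End Interpretation.

Definition scons m n (x : Fin.t n) (s : Fin.t m -> Fin.t n) (i : Fin.t (S m)) : Fin.t n :=
  Fin.caseS' i (fun _ => Fin.t n) x s.

Definition up m n (s : Fin.t m -> Fin.t n) : Fin.t (S m) -> Fin.t (S n) :=
  scons F1 (fun i => FS (s i)).

Fixpoint rename m (p : formula m) : forall n, (Fin.t m -> Fin.t n) -> formula n :=
  match p in formula m return forall n, (Fin.t m -> Fin.t n) -> formula n with
  | fEq i j => fun n s => fEq (s i) (s j)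
  | fMem i j => fun n s => fMem (s i) (s j)
  | fNot p => fun n s => fNot (rename p s)
  | fImp p q => fun n s => fImp (rename p s) (rename q s)
  | fAnd p q => fun n s => fAnd (rename p s) (rename q s)
  | fOr p q => fun n s => fOr (rename p s) (rename q s)
  | fEx p => fun n s => fEx (rename p (up s))
  | fAll p => fun n s => fAll (rename p (up s))
  end.

Definition fIff n (p q : formula n) : formula n := fAnd (fImp p q) (fImp q p).

(* The bound [i] is a variable of the context outside the quantifier. *)
Definition fAllIn n (i : Fin.t n) (p : formula (S n)) : formula n :=
  fAll (fImp (fMem F1 (FS i)) p).
Definition fExIn n (i : Fin.t n) (p : formula (S n)) : formula n :=
  fEx (fAnd (fMem F1 (FS i)) p).

Inductive Delta0 : forall n, formula n -> Type :=
| D0_Eq n (i j : Fin.t n) : Delta0 (fEq i j)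
| D0_Mem n (i j : Fin.t n) : Delta0 (fMem i j)
| D0_Not n (p : formula n) : Delta0 p -> Delta0 (fNot p)
| D0_Imp n (p q : formula n) : Delta0 p -> Delta0 q -> Delta0 (fImp p q)
| D0_And n (p q : formula n) : Delta0 p -> Delta0 q -> Delta0 (fAnd p q)
| D0_Or n (p q : formula n) : Delta0 p -> Delta0 q -> Delta0 (fOr p q)
| D0_AllIn n (i : Fin.t n) (p : formula (S n)) : Delta0 p -> Delta0 (fAllIn i p)
| D0_ExIn n (i : Fin.t n) (p : formula (S n)) : Delta0 p -> Delta0 (fExIn i p).

Definition v0 {n} : Fin.t (1 + n) := F1.
Definition v1 {n} : Fin.t (2 + n) := FS v0.
Definition v2 {n} : Fin.t (3 + n) := FS v1.
Definition v3 {n} : Fin.t (4 + n) := FS v2.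
Definition v4 {n} : Fin.t (5 + n) := FS v3.
Definition v5 {n} : Fin.t (6 + n) := FS v4.
Definition v6 {n} : Fin.t (7 + n) := FS v5.

Definition fSubset n (i j : Fin.t n) : formula n :=
  fAllIn i (fMem v0 (FS j)).

(* (exists e in x, e is empty) and
   (for all y in x, exists s in x, for all z, z in s <-> z in y \/ z = y). *)
Definition fInd n (x : Fin.t n) : formula n :=
  fAnd (fExIn x (fAll (fNot (fMem v0 v1))))
       (fAllIn x (fExIn (FS x)
          (fAll (fIff (fMem v0 v1) (fOr (fMem v0 v2) (fEq v0 v2)))))).

Definition Extensionality : formula 0 :=
  fAll (fAll (fImp (fAll (fIff (fMem v0 v2) (fMem v0 v1))) (fEq v1 v0))).

Definition EmptySet : formula 0 := fEx (fAll (fNot (fMem v0 v1))).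

Definition Pairing : formula 0 :=
  fAll (fAll (fEx (fAll (fIff (fMem v0 v1) (fOr (fEq v0 v3) (fEq v0 v2)))))).

Definition Union : formula 0 :=
  fAll (fEx (fAll (fIff (fMem v0 v1) (fExIn v2 (fMem v1 v0))))).

Definition Infinity : formula 0 := fEx (fInd v0).

Definition StrongInfinity : formula 0 :=
  fEx (fAnd (fInd v0) (fAll (fImp (fInd v0) (fSubset v1 v0)))).

Definition Powerset : formula 0 :=
  fAll (fEx (fAll (fIff (fMem v0 v1) (fSubset v0 v2)))).

(* In each scheme the comment lists the variables of the schematic formula in
   order, before its n parameters.  The variable for the asserted set is not
   among them. *)

(* phi(x, a) *)
Definition Separation n (phi : formula (2 + n)) : formula n :=
  fAll (* a *) (fEx (* w *) (fAll (* x *)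
    (fIff (fMem v0 v1)
          (fAnd (fMem v0 v2)
                (rename phi (scons v0 (scons v2 (fun i => FS (FS (FS i)))))))))).

(* phi(a) *)
Definition EpsInduction n (phi : formula (1 + n)) : formula n :=
  fImp (fAll (* a *) (fImp (fAllIn v0 (* y *)
                             (rename phi (scons v0 (fun i => FS (FS i)))))
                           phi))
       (fAll phi).

(* theta(x, y, a) *)
Definition Collection n (theta : formula (3 + n)) : formula n :=
  fAll (* a *)
    (fImp (fAllIn v0 (* x *) (fEx (* y *)
            (rename theta (scons v1 (scons v0 (scons v2 (fun i => FS (FS (FS i)))))))))
       (fEx (* b *)
          (fAllIn v1 (* x *) (fExIn v1 (* y *)
            (rename theta
               (scons v1 (scons v0 (scons v3 (fun i => FS (FS (FS (FS i)))))))))))).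

(* phi(x, y, a) *)
Definition StrongCollection n (phi : formula (3 + n)) : formula n :=
  fAll (* a *)
    (fImp (fAllIn v0 (* x *) (fEx (* y *)
            (rename phi (scons v1 (scons v0 (scons v2 (fun i => FS (FS (FS i)))))))))
       (fEx (* b *)
          (fAnd
            (fAllIn v1 (* x *) (fExIn v1 (* y *)
               (rename phi
                  (scons v1 (scons v0 (scons v3 (fun i => FS (FS (FS (FS i))))))))))
            (fAllIn v0 (* y *) (fExIn v2 (* x *)
               (rename phi
                  (scons v0 (scons v1 (scons v3 (fun i => FS (FS (FS (FS i))))))))))))).

(* psi(x, y, u, a, b) *)
Definition SubsetCollection n (psi : formula (5 + n)) : formula n :=
  fAll (* a *) (fAll (* b *) (fEx (* c *) (fAll (* u *)
    (fImp
      (fAllIn v3 (* x *) (fExIn v3 (* y *)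
         (rename psi (scons v1 (scons v0 (scons v2 (scons v5 (scons v4
            (fun i => FS (FS (FS (FS (FS (FS i))))))))))))))
      (fExIn v1 (* d *)
         (fAnd
           (fAllIn v4 (* x *) (fExIn v1 (* y *)
              (rename psi (scons v1 (scons v0 (scons v3 (scons v6
                 (scons v5
                 (fun i => FS (FS (FS (FS (FS (FS (FS i)))))))))))))))
           (fAllIn v0 (* y *) (fExIn v5 (* x *)
              (rename psi (scons v0 (scons v1 (scons v3 (scons v6
                 (scons v5
                 (fun i => FS (FS (FS (FS (FS (FS (FS i))))))))))))))))))))).

Inductive IZF : forall n, formula n -> Type :=
| IZF_Extensionality : IZF Extensionality
| IZF_EmptySet : IZF EmptySet
| IZF_Pairing : IZF Pairing
| IZF_Union : IZF Union
| IZF_Infinity : IZF Infinity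
| IZF_Powerset : IZF Powerset
| IZF_Separation n (phi : formula (2 + n)) : IZF (Separation phi)
| IZF_EpsInduction n (phi : formula (1 + n)) : IZF (EpsInduction phi)
| IZF_Collection n (theta : formula (3 + n)) : IZF (Collection theta).

Inductive CZF : forall n, formula n -> Type :=
| CZF_Extensionality : CZF Extensionality
| CZF_EmptySet : CZF EmptySet
| CZF_Pairing : CZF Pairing
| CZF_Union : CZF Union
| CZF_StrongInfinity : CZF StrongInfinity
| CZF_Separation n (phi : formula (2 + n)) : Delta0 phi -> CZF (Separation phi)
| CZF_EpsInduction n (phi : formula (1 + n)) : CZF (EpsInduction phi)
| CZF_StrongCollection n (phi : formula (3 + n)) : CZF (StrongCollection phi)
| CZF_SubsetCollection n (psi : formula (5 + n)) : CZF (SubsetCollection psi).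

(* Main.v *)
From Stdlib Require Import Fin.
Require Import Defs.

Set Implicit Arguments.
Unset Strict Implicit.

(** A set [set f] is indexed by a small type, while the formulas that separation and
    collection speak of are propositions of the large universe.  Excluded middle for
    large propositions removes this obstacle: it gives every large proposition a truth
    value in the two-element type [Two], which is small.  Hence a subset of [set f] cut
    out by any formula is again indexed by a small type ([Coll_separation]), and the
    functions from the index type to [Two] index a power set ([Coll_subset]).

    Without the axiom of choice a union needs a presentation of each member that is
    selected uniformly, whereas the elimination rule of [V] provides one only up to
    truncation.  Presentations without repetition, called listings here, solve this:
    two listings of the same set are equivalent over [V], so univalence makes the type
    of listings of a set a proposition ([Irrelevant_Listing]) and lets its truncated
    existence be used as actual existence.  A listing of [set f] exists because the
    classes of indices with equal value, as functions into [Two], form a small type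
    ([listing_set]).

    Collection follows by the trick of Scott: in place of all the witnesses for a given
    element, keep those of minimal rank.  Ranks are compared without ordinals, through
    the recursion on [V] that sends [v] to the set [stage v] of all [x] that are included
    in [stage y] for some member [y] of [v]; thus [stage v] is the level of the
    cumulative hierarchy indexed by the rank of [v], and [x] has rank at most that of
    [v] when [x] is included in [stage v].  Excluded middle makes this preorder total,
    membership induction makes it well-founded ([rank_minimal]), and the witnesses of
    minimal rank form a set because they are all included in one stage ([Coll_minimal]).
    The union of these sets proves strong collection.  In subset collection the power
    set of [b] serves for [c], with [d] separated from [b].

    The schemes are stated through renamings of variables; [interp_rename] turns these
    into changes of the valuation. *)

(** * Large types and propositions *)

Section Model.

Context {H : HoTT}.
Notation Ty := (Ty (Fib H)).

(** Largeness is a hypothesis of function extensionality, hence of the fact that a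
    product of propositions is a proposition; the two classes infer it, together with
    propositionality, from the shape of a statement. *)
Class Large (A : Ty) : Type := large : In (U' H) A.
Class Irrelevant (A : Ty) : Type := irrelevant : isProp A.

Definition Iff (A B : Ty) : Ty := Times (Arrow A B) (Arrow B A).

Definition both (A B : Ty) (a : A) (b : B) : Times A B := existT (fun _ => El B) a b.

Definition Iff_intro (A B : Ty) (f : A -> B) (g : B -> A) : Iff A B :=
  both (A := Arrow A B) (B := Arrow B A) f g.

Lemma Iff_refl (A : Ty) : Iff A A.
Proof. exact (both (A := Arrow A A) (B := Arrow A A) (fun a => a) (fun a => a)). Qed.

#[export] Instance Large_dec (A : U H) : Large (dec A) := In_cumul A.

#[export] Instance Large_Pi (A : Ty) (B : A -> Ty) :
  Large A -> (forall x, Large (B x)) -> Large (Pi B).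
Proof. apply In_Pi. Defined.

#[export] Instance Large_Arrow (A B : Ty) : Large A -> Large B -> Large (Arrow A B).
Proof. intros a b; exact (In_Pi a (fun _ => b)). Defined.

#[export] Instance Large_Sig (A : Ty) (B : A -> Ty) :
  Large A -> (forall x, Large (B x)) -> Large (Sig B).
Proof. apply In_Sig. Defined.

#[export] Instance Large_Zero : Large (Zero H).
Proof. apply In_Zero. Defined.

#[export] Instance Large_Exists (A : Ty) (B : A -> Ty) :
  Large A -> (forall x, Large (B x)) -> Large (Exists B).
Proof. intros a b; apply In_Trunc, In_Sig; assumption. Defined.

#[export] Instance Irrelevant_Pi (A : Ty) (B : A -> Ty) :
  Large A -> (forall x, Large (B x)) -> (forall x, Irrelevant (B x)) -> Irrelevant (Pi B).
Proof. intros a b h; exact (isProp_Pi a b h). Defined.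

#[export] Instance Irrelevant_Arrow (A B : Ty) :
  Large A -> Large B -> Irrelevant B -> Irrelevant (Arrow A B).
Proof. intros a b h; exact (isProp_Pi a (fun _ => b) (fun _ => h)). Defined.

#[export] Instance Irrelevant_Times (A B : Ty) :
  Irrelevant A -> Irrelevant B -> Irrelevant (Times A B).
Proof. intros hA hB u v; apply Sig_path; [intros _; exact hB | apply hA]. Defined.

#[export] Instance Irrelevant_Iff (A B : Ty) :
  Large A -> Large B -> Irrelevant A -> Irrelevant B -> Irrelevant (Iff A B).
Proof. intros; unfold Iff; exact _. Defined.

#[export] Instance Large_isProp (A : Ty) : Large A -> Large (isProp A).
Proof.
  intro a; refine (@Large_Pi _ _ a _); intro x; refine (@Large_Pi _ _ a _); intro y.
  exact (In_Id x y a).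
Defined.

#[export] Instance Irrelevant_isProp (A : Ty) : Large A -> Irrelevant (isProp A).
Proof. intro a; exact (isProp_isProp a). Defined.

#[export] Instance Irrelevant_Zero : Irrelevant (Zero H).
Proof. intros z; exact (Zero_rect (fun z => Pi (fun w => Id z w)) z). Defined.

#[export] Instance Irrelevant_Exists (A : Ty) (B : A -> Ty) : Irrelevant (Exists B).
Proof. intros x y; apply Trunc_isProp. Defined.

#[export] Instance Irrelevant_Or (A B : Ty) : Irrelevant (Or A B).
Proof. intros x y; apply Trunc_isProp. Defined.

Lemma Exists_intro (A : Ty) (B : A -> Ty) (a : A) : B a -> Exists B.
Proof. intro b; exact (tr _ (A := Sig B) (existT _ a b)). Qed.

Lemma Exists_elim (A : Ty) (B : A -> Ty) (Q : Ty) {hQ : Irrelevant Q} :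
  (forall a, B a -> Q) -> Exists B -> Q.
Proof.
  intro h; refine (Trunc_rect (P := fun _ => Q) (fun _ => hQ) _).
  intros [a b]; exact (h a b).
Qed.

Lemma Or_elim (A B Q : Ty) {hQ : Irrelevant Q} :
  (A -> Q) -> (B -> Q) -> Or A B -> Q.
Proof.
  intros h k; refine (Trunc_rect (P := fun _ => Q) (fun _ => hQ) _).
  exact (Sum_rect (P := fun _ => Q) h k).
Qed.

Lemma Zero_elim (Q : Ty) : Zero H -> Q.
Proof. exact (Zero_rect (fun _ => Q)). Qed.

(** * Function extensionality *)

(** The functions [g] paired with homotopies from [f] to [g] correspond to the sections
    of a family of contractible types, so any two of these sections are equal. *)
Lemma funext (A B : Ty) {lA : Large A} {lB : Large B} (f g : A -> B) :
  (forall x, Id (f x) (g x)) -> Id (A := Arrow A B) f g.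
Proof.
  intro h.
  destruct (@isContr_Pi H (trunc H) (U' H) A (fun x => Sig (fun y : B => Id (f x) y)))
    as [c hc].
  - exact lA.
  - intro x; apply In_Sig; [exact lB|]; intro; apply In_Id; exact lB.
  - intro x; exists (existT (fun y => El (Id (f x) y)) (f x) (refl (f x))).
    intros [y p].
    exact (J (P := fun y p => Id (A := Sig (fun y : B => Id (f x) y))
       (existT (fun y => El (Id (f x) y)) (f x) (refl (f x))) (existT _ y p)) (refl _) p).
  - pose (k1 := fun x => existT (fun y => El (Id (f x) y)) (f x) (refl (f x))).
    pose (k2 := fun x => existT (fun y => El (Id (f x) y)) (g x) (h x)).
    exact (ap (B := Arrow A B)
      (fun (k : Pi (fun x => Sig (fun y : B => Id (f x) y))) x => projT1 (k x))
      (concat (inv (hc k1)) (hc k2))).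
Qed.

(** * Truth values and excluded middle *)

Definition Two : Ty := Sum (t := H) Unit Unit.

Lemma In_U_Two : In (U H) Two.
Proof. apply In_Sum; apply In_Unit. Defined.

#[export] Instance Large_Two : Large Two.
Proof. apply In_Sum; apply In_Unit. Defined.

Definition holds (s : Two) : Ty :=
  dec (Sum_rect (P := fun _ => Code (U H)) (fun _ => code (In_Unit (U H)))
         (fun _ => code (In_Zero (U H))) s).

Lemma holds_inl u : holds (inl Unit u) = Unit.
Proof. unfold holds; rewrite Sum_rect_inl; apply dec_code. Qed.

Lemma holds_inr u : holds (inr Unit u) = Zero H.
Proof. unfold holds; rewrite Sum_rect_inr; apply dec_code. Qed.

Lemma In_U_holds s : In (U H) (holds s).
Proof. exact (mkIn eq_refl). Defined.

#[export] Instance Irrelevant_holds s : Irrelevant (holds s).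
Proof.
  refine (Sum_rect (P := fun s => isProp (holds s)) _ _ s); intro u.
  - rewrite holds_inl; intros [] []; apply refl.
  - rewrite holds_inr; exact Irrelevant_Zero.
Qed.

Lemma Two_ext (s t : Two) : Iff (holds s) (holds t) -> Id s t.
Proof.
  revert s t.
  refine (Sum_rect (P := fun s => Pi (fun t => Arrow (Iff (holds s) (holds t)) (Id s t))) _ _);
    intro u;
    refine (Sum_rect (P := fun t => Arrow (Iff (holds _) (holds t)) (Id _ t)) _ _);
    intros v; cbn; rewrite ?holds_inl, ?holds_inr.
  - intros _; destruct u, v; apply refl.
  - intros [h _]; exact (Zero_elim _ (h tt)).
  - intros [_ h]; exact (Zero_elim _ (h tt)).
  - intros _; destruct u, v; apply refl.
Qed.

Context (lem : LEM (U' H)).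

Lemma excluded_middle (P : Ty) {lP : Large P} {hP : Irrelevant P} : Sum P (Neg P).
Proof. destruct lP as [c <-]; exact (lem hP). Qed.

Lemma by_cases (P Q : Ty) {lP : Large P} {hP : Irrelevant P} :
  (P -> Q) -> (Neg P -> Q) -> Q.
Proof.
  intros h k; exact (Sum_rect (P := fun _ => Q) h k (excluded_middle (P := P))).
Qed.

Lemma by_contradiction (P : Ty) {lP : Large P} {hP : Irrelevant P} : Neg (Neg P) -> P.
Proof.
  intro h; exact (by_cases (P := P) (fun p => p) (fun k => Zero_elim _ (h k))).
Qed.

Lemma truth_value (P : Ty) {lP : Large P} {hP : Irrelevant P} :
  Sig (fun s : Two => Iff (holds s) P).
Proof.
  refine (by_cases (P := P) _ _); intro p.
  - exists (inl (A := Unit) Unit tt); rewrite holds_inl;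
    exact (both (A := Arrow Unit P) (B := Arrow P Unit) (fun _ => p) (fun _ => tt)).
  - exists (inr Unit (B := Unit) tt); rewrite holds_inr;
    exact (both (A := Arrow (Zero H) P) (B := Arrow P (Zero H)) (Zero_elim P) p).
Qed.

Definition truth (P : Ty) {lP : Large P} {hP : Irrelevant P} : Two := projT1 (truth_value (P := P)).

Lemma holds_truth (P : Ty) {lP : Large P} {hP : Irrelevant P} : Iff (holds (truth (P := P))) P.
Proof. exact (projT2 (truth_value (P := P))). Qed.

(** * Induction, extensionality and classes *)

Context (V : CumulativeHierarchy H).

#[export] Instance Large_V : Large V.
Proof. apply In_V. Defined.

#[export] Instance Large_Id (x y : V) : Large (Id x y).
Proof. apply In_Id, In_V. Defined.

#[export] Instance Irrelevant_Id (x y : V) : Irrelevant (Id x y).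
Proof. exact (@V_isSet H V x y). Defined.

#[export] Instance Large_mem (x y : V) : Large (mem x y).
Proof. exact (mkIn eq_refl). Defined.

#[export] Instance Irrelevant_mem (x y : V) : Irrelevant (mem x y).
Proof. exact (projT2 (mem_prop x y)). Defined.

Lemma V_prop_ind (P : V -> Ty) {hP : forall v, Irrelevant (P v)} :
  (forall (A : U H) (f : dec A -> V), (forall a, P (f a)) -> P (set f)) -> forall v, P v.
Proof.
  intro h.
  refine (V_ind (c := V) (P := P) (fun v => @isSet_of_isProp _ _ (hP v)) (h := h) _).
  intros; apply hP.
Qed.

Lemma V_presented (v : V) :
  Exists (fun A : U H => Exists (fun f : Arrow (dec A) V => Id v (set f))).
Proof.
  revert v; refine (V_prop_ind _).
  intros A f _; apply (Exists_intro (a := A)), (Exists_intro (A := Arrow (dec A) V) (a := f)), refl.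
Qed.

Lemma mem_set_iff (A : U H) (f : dec A -> V) (x : V) :
  Iff (mem x (set f)) (Exists (fun a => Id x (f a))).
Proof. rewrite mem_set; apply Iff_refl. Qed.

Lemma mem_set_intro (A : U H) (f : dec A -> V) (a : dec A) : mem (f a) (set f).
Proof. apply (projT2 (mem_set_iff f (f a))), (Exists_intro (a := a)), refl. Qed.

Lemma eps_induction (P : V -> Ty) {hP : forall v, Irrelevant (P v)} :
  (forall a, (forall y, mem y a -> P y) -> P a) -> forall a, P a.
Proof.
  intro h; refine (V_prop_ind _); intros A f IH; apply h; intros y hy.
  generalize (projT1 (mem_set_iff f y) hy); refine (Exists_elim _); intros a p.
  exact (transport (P := P) (inv p) (IH a)).
Qed.

Lemma extensionality (a b : V) : (forall x, Iff (mem x a) (mem x b)) -> Id a b.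
Proof.
  intro h.
  generalize (V_presented a); refine (Exists_elim _); intro A; refine (Exists_elim _); intros f p.
  generalize (V_presented b); refine (Exists_elim _); intro B; refine (Exists_elim _); intros g q.
  refine (concat p (concat _ (inv q))); apply set_path.
  assert (k : forall x, Iff (mem x (set f)) (mem x (set g))).
  { intro x; refine (transport (P := fun a => Iff (mem x a) _) p _).
    exact (transport (P := fun b => Iff (mem x a) (mem x b)) q (h x)). }
  apply both.
  - intro a'; exact (projT1 (mem_set_iff g _) (projT1 (k _) (mem_set_intro f a'))).
  - intro b'.
    generalize (projT1 (mem_set_iff f _) (projT2 (k _) (mem_set_intro g b'))).
    refine (Exists_elim _); intros a' r; exact (Exists_intro (a := a') (inv r)).
Qed.

(** The class [phi] is a set.  By extensionality this is a proposition, so a set known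
    to exist only up to truncation is available outright. *)
Definition Coll (phi : V -> Ty) : Ty := Sig (fun w : V => Pi (fun x => Iff (mem x w) (phi x))).

#[export] Instance Irrelevant_Coll (phi : V -> Ty) (lphi : forall x, Large (phi x))
    (hphi : forall x, Irrelevant (phi x)) : Irrelevant (Coll phi).
Proof.
  intros [w hw] [w' hw']; apply Sig_path; [intro; apply irrelevant|]; cbn.
  apply extensionality; intro x; apply both; intro h.
  - exact (projT2 (hw' x) (projT1 (hw x) h)).
  - exact (projT2 (hw x) (projT1 (hw' x) h)).
Qed.

Lemma Coll_iff (phi psi : V -> Ty) : (forall x, Iff (phi x) (psi x)) -> Coll phi -> Coll psi.
Proof.
  intros h [w hw]; exists w; intro x; apply both; intro k.
  - exact (projT1 (h x) (projT1 (hw x) k)).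
  - exact (projT2 (hw x) (projT2 (h x) k)).
Qed.

Lemma Coll_image (A : Ty) (iA : In (U H) A) (f : A -> V) :
  Coll (fun x => Exists (fun a : A => Id x (f a))).
Proof. destruct iA as [c <-]; exists (set f); exact (mem_set_iff f). Qed.

(** * Canonical presentations *)

Definition Fiber (A : Ty) (m : A -> V) (x : V) : Ty := Sig (fun a => Id x (m a)).

Definition fib (A : Ty) (m : A -> V) (x : V) (a : A) (p : Id x (m a)) : Fiber m x :=
  existT (fun a => El (Id x (m a))) a p.

Lemma Irrelevant_Fiber (A : Ty) (m : A -> V) :
  (forall a b, Id (m a) (m b) -> Id a b) -> forall x, Irrelevant (Fiber m x).
Proof.
  intros h x [a p] [b q]; apply Sig_path; [intro; apply irrelevant|]; cbn.
  exact (h a b (concat (inv p) q)).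
Qed.

(** Embeddings reflect being a set: a path [p] in [A] yields, through the fibre over
    [m x], a path that depends on [ap m p] alone, and [V] is a set. *)
Lemma isSet_of_fibers (A : Ty) (m : A -> V) (h : forall x, Irrelevant (Fiber m x)) : isSet A.
Proof.
  apply isSet_of_const with (f := fun x y p =>
    ap (fun u : Fiber m (m x) => projT1 u)
       (h (m x) (fib (m := m) (x := m x) (a := x) (refl _))
          (fib (m := m) (x := m x) (a := y) (ap m p)))).
  intros x y p q.
  exact (ap (B := Id x y) (fun r => ap (fun u : Fiber m (m x) => projT1 u)
       (h (m x) (fib (m := m) (x := m x) (a := x) (refl _))
          (fib (m := m) (x := m x) (a := y) r))) (irrelevant (ap m p) (ap m q))).
Qed.

Definition Family : Ty := Sig (fun A : U H => Arrow (dec A) V).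

Definition family (A : U H) (m : dec A -> V) : Family :=
  existT (fun A : U H => El (Arrow (dec A) V)) A m.

(** Univalence replaces [e] by a path, and induction on the path reduces the claim to
    the identity equivalence, where it is function extensionality. *)
Lemma family_path (A B : U H) (e : Equiv (dec A) (dec B)) (m : dec A -> V) (n : dec B -> V) :
  (forall a, Id (m a) (n (projT1 e a))) -> Id (family m) (family n).
Proof.
  revert n.
  destruct (univalence (U H) A B e) as [[p q] _]; cbn in p, q.
  refine (transport (P := fun e : Equiv (dec A) (dec B) => Pi (fun n : Arrow (dec B) V =>
    Arrow (Pi (fun a => Id (m a) (n (projT1 e a)))) (Id (family m) (family n)))) q _).
  refine (J (P := fun B p => Pi (fun n : Arrow (dec B) V =>
    Arrow (Pi (fun a => Id (m a) (n (projT1 (idtoeqv p) a)))) (Id (family m) (family n)))) _ p).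
  unfold idtoeqv; rewrite J_refl; cbn; intros n h.
  exact (ap (A := Arrow (dec A) V) (B := Family) (fun k => family k) (funext h)).
Qed.

(** With propositional fibres, the listed family has no repetition, so membership is
    expressed by an untruncated index. *)
Definition IsListing (v : V) (u : Family) : Ty :=
  Pi (fun x : V => Times (isProp (Fiber (projT2 u) x)) (Iff (mem x v) (Fiber (projT2 u) x))).

#[export] Instance Irrelevant_IsListing (v : V) (u : Family) : Irrelevant (IsListing v u).
Proof.
  refine (@Irrelevant_Pi V _ _ _ _); intros x [h g] [h' g']; apply Sig_path.
  - intro i; pose proof (i : Irrelevant (Fiber (projT2 u) x)).
    exact (Irrelevant_Iff (A := mem x v) (B := Fiber (projT2 u) x) _ _ _ _).
  - apply (Irrelevant_isProp (A := Fiber (projT2 u) x)); exact _.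
Qed.

Definition Listing (v : V) : Ty := Sig (fun u : Family => IsListing v u).

(** The index of [m a] in the second listing defines the map.  It is an equivalence
    because the value at an index determines that index in either listing. *)
Lemma listing_equiv (v : V) (A B : U H) (m : dec A -> V) (n : dec B -> V)
    (hm : IsListing v (family m)) (hn : IsListing v (family n)) :
  Sig (fun e : Equiv (dec A) (dec B) => Pi (fun a => Id (m a) (n (projT1 e a)))).
Proof.
  unfold IsListing in *; cbn in hm, hn.
  pose (s := fun a => projT1 (projT2 (hn (m a))) (projT2 (projT2 (hm (m a)))
               (fib (m := m) (x := m a) (a := a) (refl _)))).
  pose (t := fun b => projT1 (projT2 (hm (n b))) (projT2 (projT2 (hn (n b)))
               (fib (m := n) (x := n b) (a := b) (refl _)))).
  pose (e := fun a => projT1 (s a)).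
  assert (he : forall a, Id (m a) (n (e a))) by (intro a; exact (projT2 (s a))).
  assert (sB : isSet (dec B)).
  { apply (isSet_of_fibers (m := n)); intro x; exact (projT1 (hn x)). }
  assert (q : isEquiv e).
  { intro b; destruct (t b) as [a p].
    assert (r : Id (e a) b).
    { exact (ap (fun u : Fiber n (m a) => projT1 u) (projT1 (hn (m a))
        (fib (m := n) (x := m a) (a := e a) (he a))
        (fib (m := n) (x := m a) (a := b) (inv p)))). }
    exists (existT (fun a => El (Id (e a) b)) a r); intros [a' r'].
    apply Sig_path; [intro; apply sB|]; cbn.
    exact (ap (fun u : Fiber m (n b) => projT1 u) (projT1 (hm (n b))
        (fib (m := m) (x := n b) (a := a) p)
        (fib (m := m) (x := n b) (a := a') (inv (concat (he a') (ap n r')))))). }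
  exists (existT (fun f : Arrow (dec A) (dec B) => El (isEquiv f)) e q); exact he.
Qed.

#[export] Instance Irrelevant_Listing (v : V) : Irrelevant (Listing v).
Proof.
  intros [[A m] hm] [[B n] hn]; apply Sig_path; cbn.
  - intro u; apply Irrelevant_IsListing.
  - destruct (listing_equiv hm hn) as [e he]; exact (family_path he).
Qed.

Lemma listing_intro (v : V) (A : Ty) (iA : In (U H) A) (m : A -> V)
    (hm : forall x, Irrelevant (Fiber m x)) (h : forall x, Iff (mem x v) (Fiber m x)) :
  Listing v.
Proof.
  destruct iA as [c <-]; exists (family m); intro x; exact (both (hm x) (h x)).
Qed.

Section Quotient.

Context (A : U H) (f : dec A -> V).

Definition Part : Ty := Arrow (dec A) Two.

(** The class of [a] is a function into [Two], since the type [Id (f a) (f b)] itself is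
    large and would not give a small type of classes. *)
Definition class (a b : dec A) : Two := truth (P := Id (f a) (f b)).

Definition Classes : Ty :=
  Sig (fun S : Part => Exists (fun a => Id (A := Part) (class a) S)).

Lemma In_U_Classes : In (U H) Classes.
Proof.
  assert (i : In (U H) Part).
  { apply In_Pi; [exact (mkIn eq_refl) | intro; exact In_U_Two]. }
  apply In_Sig; [exact i|]; intro S.
  apply In_Trunc, In_Sig; [exact (mkIn eq_refl)|]; intro a; apply In_Id, i.
Defined.

Lemma class_iff (a : dec A) (S : Part) (p : Id (A := Part) (class a) S) b :
  Iff (holds (S b)) (Id (f a) (f b)).
Proof.
  exact (transport (P := fun S : Part => Iff (holds (S b)) (Id (f a) (f b))) p
    (holds_truth (P := Id (f a) (f b)))).
Qed.

(** The common value of [f] on a class is unique, so it can be extracted from the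
    truncated statement that the class has a representative. *)
Lemma class_value (q : Classes) :
  Sig (fun y => Exists (fun a =>
    Times (Id (A := Part) (class a) (projT1 q)) (Id y (f a)))).
Proof.
  assert (i : Irrelevant (Sig (fun y => Exists (fun a =>
     Times (Id (A := Part) (class a) (projT1 q)) (Id y (f a)))))).
  { intros [y h] [y' h']; apply Sig_path; [intro; apply irrelevant|]; cbn.
    revert h; refine (Exists_elim _); intros a [p r].
    revert h'; refine (Exists_elim _); intros a' [p' r'].
    refine (concat r (concat (inv _) (inv r'))).
    apply (projT1 (class_iff p' a)), (projT2 (class_iff p a)), refl. }
  generalize (projT2 q); refine (Exists_elim _); intros a p.
  exists (f a); exact (Exists_intro (a := a) (both p (refl _))).
Qed.

(** Two classes with the same value of [f] are equal, so [class_value] is an embedding. *)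
Lemma listing_set : Listing (set f).
Proof.
  pose (m := fun q : Classes => projT1 (class_value q)).
  pose proof (fun q => projT2 (class_value q)) as hm; cbn in hm.
  assert (i : forall x, Irrelevant (Fiber m x)).
  { apply Irrelevant_Fiber; intros q q' r.
    apply Sig_path; [intro; apply Irrelevant_Exists|].
    (* Equality of classes is not known to be a proposition here, so it is reduced to
       equivalences of truth values before representatives are chosen. *)
    refine (funext _); intro b; apply Two_ext.
    generalize (hm q); refine (Exists_elim _); intros a [p t].
    generalize (hm q'); refine (Exists_elim _); intros a' [p' t'].
    pose proof (concat (inv t) (concat r t')) as k.
    apply both; intro h.
    - apply (projT2 (class_iff p' b)).
      exact (concat (inv k) (projT1 (class_iff p b) h)).
    - apply (projT2 (class_iff p b)).
      exact (concat k (projT1 (class_iff p' b) h)). }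
  apply (listing_intro In_U_Classes i); intro x; apply both; intro h.
  - generalize (projT1 (mem_set_iff f x) h); refine (Exists_elim _); intros a p.
    pose (q := existT (fun S : Part => El (Exists (fun a =>
       Id (A := Part) (class a) S))) (class a)
       (Exists_intro (a := a) (refl (A := Part) (class a)))).
    apply (fib (m := m) (x := x) (a := q)).
    generalize (hm q); refine (Exists_elim _); intros a' [p' t].
    refine (concat p (concat (inv _) (inv t))).
    apply (projT1 (class_iff p' a)), (projT2 (holds_truth (P := Id (f a) (f a)))), refl.
  - destruct h as [q r]; generalize (hm q); refine (Exists_elim _); intros a [p t].
    apply (projT2 (mem_set_iff f x)), (Exists_intro (a := a)); exact (concat r t).
Qed.

End Quotient.

(** A listing is unique, so its existence may be proved by induction on [v] into a
    proposition. *)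
Lemma listing (v : V) : Listing v.
Proof. revert v; refine (V_prop_ind _); intros A f _; apply listing_set. Qed.

Definition index (v : V) : U H := projT1 (projT1 (listing v)).
Definition elt (v : V) : dec (index v) -> V := projT2 (projT1 (listing v)).

Lemma mem_elt (v x : V) : Iff (mem x v) (Fiber (elt (v := v)) x).
Proof. exact (projT2 (projT2 (listing v) x)). Qed.

Lemma elt_mem (v : V) (a : dec (index v)) : mem (elt a) v.
Proof. exact (projT2 (mem_elt v _) (fib (m := elt (v := v)) (refl _))). Qed.

(** * Constructions of sets *)

Lemma Coll_separation (v : V) (phi : V -> Ty) {lphi : forall x, Large (phi x)}
    {hphi : forall x, Irrelevant (phi x)} : Coll (fun x => Times (mem x v) (phi x)).
Proof.
  pose (I := Sig (fun a : dec (index v) => holds (truth (P := phi (elt a))))).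
  assert (iI : In (U H) I) by (apply In_Sig; intros; exact (mkIn eq_refl)).
  refine (Coll_iff _ (Coll_image iI (fun i => elt (projT1 i)))).
  intro x; apply both.
  - refine (Exists_elim _); intros [a h] p.
    refine (transport (P := fun x => Times (mem x v) (phi x)) (inv p) _).
    exact (both (elt_mem a) (projT1 (holds_truth (P := phi (elt a))) h)).
  - intros [h k]; destruct (projT1 (mem_elt v x) h) as [a p].
    refine (Exists_intro (A := I) (a := existT _ a _) p).
    exact (projT2 (holds_truth (P := phi (elt a))) (transport (P := phi) p k)).
Qed.

(** The canonical listings of the sets [F y] give a dependent sum of small index types;
    with presentations known only up to truncation this sum could not be formed. *)
Lemma Coll_union (v : V) (F : V -> V) :
  Coll (fun x => Exists (fun y => Times (mem y v) (mem x (F y)))).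
Proof.
  pose (I := Sig (fun a : dec (index v) => dec (index (F (elt a))))).
  assert (iI : In (U H) I) by (apply In_Sig; intros; exact (mkIn eq_refl)).
  refine (Coll_iff _ (Coll_image iI (fun i => elt (projT2 i)))).
  intro x; apply both.
  - refine (Exists_elim _); intros [a b] p; cbn in p.
    apply (Exists_intro (a := elt a)), both; [apply elt_mem|].
    exact (transport (P := fun x => mem x (F (elt a))) (inv p) (elt_mem b)).
  - refine (Exists_elim _); intros y [h k].
    destruct (projT1 (mem_elt v y) h) as [a p].
    pose proof (transport (P := fun y => mem x (F y)) p k) as k'.
    destruct (projT1 (mem_elt _ x) k') as [b q].
    exact (Exists_intro (A := I) (a := existT _ a b) q).
Qed.

Definition Subset (x y : V) : Ty := Pi (fun z => Arrow (mem z x) (mem z y)).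

(** A subset of [v] is determined by the truth values, on the index type of [v], of
    membership in it; the functions from that type to [Two] form a small type. *)
Lemma Coll_subset (v : V) : Coll (fun x => Subset x v).
Proof.
  pose (part := fun s : Arrow (dec (index v)) Two =>
    Coll_image (A := Sig (fun a : dec (index v) => holds (s a)))
      (In_Sig (mkIn eq_refl) (fun a => In_U_holds (s a))) (fun i => elt (projT1 i))).
  assert (iS : In (U H) (Arrow (dec (index v)) Two)).
  { apply In_Pi; [exact (mkIn eq_refl) | intros _; exact In_U_Two]. }
  refine (Coll_iff _ (Coll_image iS (fun s => projT1 (part s)))).
  intro x; apply both.
  - refine (Exists_elim _); intros s p.
    refine (transport (P := fun x => Subset x v) (inv p) _); intros z h.
    generalize (projT1 (projT2 (part s) z) h); refine (Exists_elim _); intros [a k] q; cbn in q.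
    exact (transport (P := fun z => mem z v) (inv q) (elt_mem a)).
  - intro h.
    pose (s := fun a : dec (index v) => truth (P := mem (elt a) x)).
    apply (Exists_intro (A := Arrow (dec (index v)) Two) (a := s)).
    apply extensionality; intro z; apply both; intro k.
    + apply (projT2 (projT2 (part s) z)).
      destruct (projT1 (mem_elt v z) (h z k)) as [a p].
      refine (Exists_intro (A := Sig (fun a : dec (index v) => holds (s a))) (a := existT _ a _) p).
      exact (projT2 (holds_truth (P := mem (elt a) x)) (transport (P := fun z => mem z x) p k)).
    + generalize (projT1 (projT2 (part s) z) k); refine (Exists_elim _); intros [a t] q; cbn in q.
      refine (transport (P := fun z => mem z x) (inv q) _).
      exact (projT1 (holds_truth (P := mem (elt a) x)) t).
Qed.

Lemma Coll_pair (a b : V) : Coll (fun x => Or (Id x a) (Id x b)).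
Proof.
  pose (f := Sum_rect (A := Unit) (B := Unit) (P := fun _ => V) (fun _ => a) (fun _ => b)).
  refine (Coll_iff _ (Coll_image In_U_Two f)); intro x; apply both.
  - refine (Exists_elim _).
    refine (Sum_rect (P := fun s => Arrow (Id x (f s)) (Or (Id x a) (Id x b))) _ _);
      intro u; unfold f; rewrite ?Sum_rect_inl, ?Sum_rect_inr; intro p; apply tr.
    + exact (inl _ p).
    + exact (inr _ p).
  - refine (Or_elim _ _); intro p.
    + apply (Exists_intro (A := Two) (a := inl (A := Unit) Unit tt)).
      unfold f; rewrite Sum_rect_inl; exact p.
    + apply (Exists_intro (A := Two) (a := inr Unit (B := Unit) tt)).
      unfold f; rewrite Sum_rect_inr; exact p.
Qed.

Lemma Coll_empty : Coll (fun _ => Zero H).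
Proof.
  refine (Coll_iff _ (Coll_image (In_Zero (U H)) (Zero_rect (fun _ => V)))).
  intro x; refine (Iff_intro _ (Zero_elim _)).
  refine (Exists_elim _); intros z _; exact z.
Qed.

(** The successor of [y] is the union of the pair of [y] and its singleton. *)
Lemma Coll_succ (y : V) : Coll (fun x => Or (mem x y) (Id x y)).
Proof.
  destruct (Coll_pair y y) as [p hp], (Coll_pair y (projT1 (Coll_pair y y))) as [q hq].
  refine (Coll_iff _ (Coll_union q (fun z => z))); intro x; apply both.
  - refine (Exists_elim _); intros z [h k].
    generalize (projT1 (hq z) h); refine (Or_elim _ _); intro r.
    + exact (tr _ (inl _ (transport (P := fun z => mem x z) r k))).
    + pose proof (transport (P := fun z => mem x z) r k) as k'.
      generalize (projT1 (projT2 (Coll_pair y y) x) k').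
      refine (Or_elim _ _); intro t; exact (tr _ (inr _ t)).
  - refine (Or_elim _ _); intro h.
    + refine (Exists_intro (a := y) (both _ h)).
      exact (projT2 (hq y) (tr _ (inl _ (refl y)))).
    + apply (Exists_intro (a := projT1 (Coll_pair y y))), both.
      * exact (projT2 (hq _) (tr _ (inr _ (refl _)))).
      * exact (projT2 (projT2 (Coll_pair y y) x) (tr _ (inl _ h))).
Qed.

(** * The natural numbers *)

Definition IsEmpty (e : V) : Ty := Pi (fun z => Neg (mem z e)).

Definition IsSucc (s y : V) : Ty := Pi (fun z => Iff (mem z s) (Or (mem z y) (Id z y))).

Definition IsInductive (x : V) : Ty :=
  Times (Exists (fun e => Times (mem e x) (IsEmpty e)))
        (Pi (fun y => Arrow (mem y x) (Exists (fun s => Times (mem s x) (IsSucc s y))))).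

Definition numeral : Nat H -> V :=
  Nat_rect (P := fun _ => V) (projT1 Coll_empty) (fun _ y => projT1 (Coll_succ y)).

Definition omega : V := projT1 (Coll_image (In_Nat (U H)) numeral).

Lemma mem_omega x : Iff (mem x omega) (Exists (fun n => Id x (numeral n))).
Proof. exact (projT2 (Coll_image (In_Nat (U H)) numeral) x). Qed.

Lemma numeral_mem n : mem (numeral n) omega.
Proof. apply (projT2 (mem_omega _)), (Exists_intro (a := n)), refl. Qed.

Lemma IsEmpty_zero : IsEmpty (numeral (zero H)).
Proof.
  unfold numeral; rewrite Nat_rect_zero; intros z h; exact (projT1 (projT2 Coll_empty z) h).
Qed.

Lemma IsSucc_succ n : IsSucc (numeral (succ n)) (numeral n).
Proof. unfold numeral; rewrite Nat_rect_succ; exact (projT2 (Coll_succ _)). Qed.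

Lemma IsInductive_omega : IsInductive omega.
Proof.
  apply both.
  - refine (Exists_intro (a := numeral (zero H)) (both _ IsEmpty_zero)).
    apply numeral_mem.
  - intros y h; generalize (projT1 (mem_omega y) h); refine (Exists_elim _); intros n p.
    refine (transport (P := fun y => Exists (fun s => Times (mem s omega) (IsSucc s y))) (inv p) _).
    refine (Exists_intro (a := numeral (succ n)) (both _ (IsSucc_succ n))).
    apply numeral_mem.
Qed.

Lemma omega_least (b : V) : IsInductive b -> Subset omega b.
Proof.
  intros [h0 hS].
  assert (h : forall n, mem (numeral n) b).
  { refine (Nat_rect (P := fun n => mem (numeral n) b) _ _).
    - revert h0; refine (Exists_elim _); intros e [k he].
      refine (transport (P := fun e => mem e b) (extensionality _) k); intro z; apply both; intro t.
      + exact (Zero_elim _ (he z t)).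
      + exact (Zero_elim _ (IsEmpty_zero t)).
    - intros n IH; generalize (hS _ IH); refine (Exists_elim _); intros s [k hs].
      refine (transport (P := fun e => mem e b) (extensionality _) k); intro z; apply both; intro t.
      + exact (projT2 (IsSucc_succ n z) (projT1 (hs z) t)).
      + exact (projT2 (hs z) (projT1 (IsSucc_succ n z) t)). }
  intros x k; generalize (projT1 (mem_omega x) k); refine (Exists_elim _); intros n p.
  exact (transport (P := fun x => mem x b) (inv p) (h n)).
Qed.

(** * Comparison of ranks *)

(** This is the clause for [set f] of the recursion that defines [stage], where [r a] is
    the stage of [f a]. *)
Lemma Coll_below (A : U H) (r : dec A -> V) : Coll (fun x => Exists (fun a => Subset x (r a))).
Proof.
  pose (I := Sig (fun a : dec A => dec (index (projT1 (Coll_subset (r a)))))).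
  assert (iI : In (U H) I) by (apply In_Sig; intros; exact (mkIn eq_refl)).
  refine (Coll_iff _ (Coll_image iI (fun i => elt (projT2 i)))).
  intro x; apply both.
  - refine (Exists_elim _); intros [a b] p; cbn in p.
    apply (Exists_intro (a := a)), (projT1 (projT2 (Coll_subset (r a)) x)).
    exact (transport (P := fun x => mem x _) (inv p) (elt_mem b)).
  - refine (Exists_elim _); intros a h.
    destruct (projT1 (mem_elt _ x) (projT2 (projT2 (Coll_subset (r a)) x) h)) as [b q].
    exact (Exists_intro (A := I) (a := existT _ a b) q).
Qed.

Lemma PathOver_const_inv (A B : Ty) (x y : A) (p : Id x y) (u v : B) :
  PathOver (P := fun _ => B) p u v -> Id u v.
Proof.
  refine (J (P := fun y p => Arrow (PathOver (P := fun _ => B) (y := y) p u v) (Id u v)) _ p).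
  unfold PathOver, transport; rewrite J_refl; exact (fun q => q).
Qed.

(** The set of [Coll_below] depends only on the values of [r], which agree for bisimilar
    index families. *)
Lemma stage_path (A B : U H) (f : dec A -> V) (g : dec B -> V) (w : bisim f g)
    (r : dec A -> V) (s : dec B -> V) :
  (forall a, Exists (fun b : dec B => Exists (fun p : Id (f a) (g b) =>
     PathOver (P := fun _ => V) p (r a) (s b)))) ->
  (forall b, Exists (fun a : dec A => Exists (fun p : Id (f a) (g b) =>
     PathOver (P := fun _ => V) p (r a) (s b)))) ->
  PathOver (P := fun _ => V) (set_path w) (projT1 (Coll_below r)) (projT1 (Coll_below s)).
Proof.
  intros hr hs; apply PathOver_const, extensionality; intro x; apply both; intro h.
  - apply (projT2 (projT2 (Coll_below s) x)).
    generalize (projT1 (projT2 (Coll_below r) x) h); refine (Exists_elim _); intros a k.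
    generalize (hr a); refine (Exists_elim _); intro b; refine (Exists_elim _); intros p q.
    apply (Exists_intro (a := b)).
    exact (transport (P := fun y => Subset x y) (PathOver_const_inv q) k).
  - apply (projT2 (projT2 (Coll_below r) x)).
    generalize (projT1 (projT2 (Coll_below s) x) h); refine (Exists_elim _); intros b k.
    generalize (hs b); refine (Exists_elim _); intro a; refine (Exists_elim _); intros p q.
    apply (Exists_intro (a := a)).
    exact (transport (P := fun y => Subset x y) (inv (PathOver_const_inv q)) k).
Qed.

Definition stage : V -> V :=
  V_ind (c := V) (P := fun _ => V) (fun _ => @V_isSet H V)
    (h := fun A f r => projT1 (Coll_below r)) stage_path.

(** The rank of [x] is at most the rank of [y]: [stage y] collects the sets of smaller
    rank than [y]. *)
Definition RankLe (x y : V) : Ty := Subset x (stage y).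

Lemma mem_stage (x v : V) :
  Iff (mem x (stage v)) (Exists (fun y => Times (mem y v) (RankLe x y))).
Proof.
  generalize (V_presented v); refine (Exists_elim _); intro A; refine (Exists_elim _); intros f p.
  refine (transport (P := fun v => Iff (mem x (stage v))
    (Exists (fun y => Times (mem y v) (RankLe x y)))) (inv p) _).
  unfold stage at 1; rewrite V_ind_set; apply both; intro h.
  - generalize (projT1 (projT2 (Coll_below _) x) h); refine (Exists_elim _); intros a k.
    exact (Exists_intro (a := f a) (both (mem_set_intro f a) k)).
  - apply (projT2 (projT2 (Coll_below _) x)).
    revert h; refine (Exists_elim _); intros y [k l].
    generalize (projT1 (mem_set_iff f y) k); refine (Exists_elim _); intros a q.
    exact (Exists_intro (a := a) (transport (P := fun y => RankLe x y) q l)).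
Qed.

#[export] Instance Large_Subset x y : Large (Subset x y).
Proof. unfold Subset; exact _. Defined.
#[export] Instance Irrelevant_Subset x y : Irrelevant (Subset x y).
Proof. unfold Subset; exact _. Defined.

Definition RankLt (x y : V) : Ty := Exists (fun z => Times (mem z y) (RankLe x z)).

Lemma RankLe_refl (x : V) : RankLe x x.
Proof.
  revert x; refine (eps_induction _); intros x IH y h.
  exact (projT2 (mem_stage y x) (Exists_intro (a := y) (both h (IH y h)))).
Qed.

Lemma RankLe_trans (x y z : V) : RankLe x y -> RankLe y z -> RankLe x z.
Proof.
  intro h.
  assert (k : RankLe y z -> RankLe x z); [|exact k].
  revert z x y h.
  refine (eps_induction (P := fun z => Pi (fun x => Pi (fun y =>
    Arrow (RankLe x y) (Arrow (RankLe y z) (RankLe x z))))) _).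
  intros z IH x y h k u hu.
  apply (projT2 (mem_stage u z)).
  generalize (projT1 (mem_stage u y) (h u hu)); refine (Exists_elim _); intros y' [hy l].
  generalize (projT1 (mem_stage y' z) (k y' hy)); refine (Exists_elim _); intros z' [hz l'].
  exact (Exists_intro (a := z') (both hz (IH z' hz u y' l l'))).
Qed.

(** Totality of the comparison.  A member [z] of [x] outside [stage y] is not below any
    member of [y]; by induction each member of [y] is then strictly below [z], that is,
    [y] is below [z]. *)
Lemma RankLt_of_not_RankLe (x y : V) : Neg (RankLe x y) -> RankLt y x.
Proof.
  revert x y.
  refine (eps_induction (P := fun x => Pi (fun y => Arrow (Neg (RankLe x y)) (RankLt y x))) _).
  intros x IH y h; refine (by_contradiction _); intro k; apply h; intros z hz.
  refine (by_contradiction _); intro l; apply k.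
  apply (Exists_intro (a := z)), both; [exact hz|]; intros w hw.
  apply (projT2 (mem_stage w z)), (IH z hz w); intro t; apply l.
  exact (projT2 (mem_stage z y) (Exists_intro (a := w) (both hw t))).
Qed.

(** If [y] in [C] is not minimal, some element of [C] lies below a member of [y], hence
    below a member of any bound [b] of [y]; the induction is on [b] because [y] itself
    is not related by membership to that element. *)
Lemma rank_minimal (C : V -> Ty) {lC : forall x, Large (C x)} {hC : forall x, Irrelevant (C x)} :
  Exists C ->
  Exists (fun y => Times (C y) (Pi (fun z => Arrow (C z) (RankLe y z)))).
Proof.
  pose (Min := Exists (fun y => Times (C y) (Pi (fun z => Arrow (C z) (RankLe y z))))).
  assert (h : forall b y, RankLe y b -> C y -> Min).
  { refine (eps_induction (P := fun b => Pi (fun y => Arrow (RankLe y b) (Arrow (C y) Min))) _).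
    intros b IH y hy cy; unfold Min; refine (by_contradiction _); intro k; apply k.
    apply (Exists_intro (a := y)), both; [exact cy|]; intros z cz.
    refine (by_contradiction _); intro l; apply k.
    generalize (RankLt_of_not_RankLe l); refine (Exists_elim _); intros u [hu zu].
    generalize (projT1 (mem_stage u b) (hy u hu)); refine (Exists_elim _); intros w [hw uw].
    exact (IH w hw z (RankLe_trans zu uw) cz). }
  refine (Exists_elim _); intros y cy; exact (h y y (RankLe_refl (x := y)) cy).
Qed.

(** * Collection *)

(** All elements of minimal rank are subsets of the stage of any one of them. *)
Lemma Coll_minimal (C : V -> Ty) {lC : forall x, Large (C x)} {hC : forall x, Irrelevant (C x)} :
  Coll (fun y => Times (C y) (Pi (fun z => Arrow (C z) (RankLe y z)))).
Proof.
  refine (by_cases (P := Exists C) _ _); intro h.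
  - generalize (rank_minimal h); refine (Exists_elim _); intros y [cy hy].
    destruct (Coll_subset (stage y)) as [w hw].
    refine (Coll_iff _ (Coll_separation w (phi := fun y =>
      Times (C y) (Pi (fun z => Arrow (C z) (RankLe y z)))))).
    intro x; apply both.
    + intros [_ k]; exact k.
    + intros [cx hx]; apply both; [|exact (both cx hx)].
      exact (projT2 (hw x) (hx y cy)).
  - refine (Coll_iff _ Coll_empty); intro x; refine (Iff_intro (Zero_elim _) _).
    intros [cx _]; exact (h (Exists_intro (a := x) cx)).
Qed.

(** The map sending [x] to its witnesses of minimal rank is a function, which is what
    allows the union over [a] without choosing a witness. *)
Lemma strong_collection (a : V) (phi : V -> V -> Ty) {lphi : forall x y, Large (phi x y)}
    {hphi : forall x y, Irrelevant (phi x y)} :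
  (forall x, mem x a -> Exists (fun y => phi x y)) ->
  Exists (fun b => Times
    (Pi (fun x => Arrow (mem x a) (Exists (fun y => Times (mem y b) (phi x y)))))
    (Pi (fun y => Arrow (mem y b) (Exists (fun x => Times (mem x a) (phi x y)))))).
Proof.
  intro h.
  pose (m := fun x => Coll_minimal (C := phi x)).
  destruct (Coll_union a (fun x => projT1 (m x))) as [b hb].
  apply (Exists_intro (a := b)), both.
  - intros x hx; generalize (rank_minimal (h x hx)); refine (Exists_elim _); intros y k.
    (* By its minimal rank, the witness [y] belongs to the set [projT1 (m x)]. *)
    refine (Exists_intro (a := y) (both _ (projT1 k))).
    apply (projT2 (hb y)), (Exists_intro (a := x)), both; [exact hx|].
    exact (projT2 (projT2 (m x) y) k).
  - intros y hy; generalize (projT1 (hb y) hy); refine (Exists_elim _); intros x [hx k].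
    exact (Exists_intro (a := x) (both hx (projT1 (projT1 (projT2 (m x) y) k)))).
Qed.

(** * Renaming of variables *)

Lemma lookup_scons m n (x : Fin.t n) (s : Fin.t m -> Fin.t n) (t : power V n) (y : V)
    (t' : power V m) :
  y = lookup x t -> (forall i, lookup i t' = lookup (s i) t) ->
  forall i, lookup i (push y t') = lookup (scons x s i) t.
Proof.
  intros h k i; exact (Fin.caseS' i (fun i => lookup i (push y t') = lookup (scons x s i) t) h k).
Qed.

Lemma interp_rename m (p : formula m) : forall n (s : Fin.t m -> Fin.t n) (t : power V n)
    (t' : power V m), (forall i, lookup i t' = lookup (s i) t) ->
  Iff (interp (rename p s) t) (interp p t').
Proof.
  induction p as [k i j|k i j|k p IHp|k p IHp q IHq|k p IHp q IHq|k p IHp q IHq|k p IHp|k p IHp];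
    intros n s t t' h; cbn [interp rename].
  - rewrite !h; apply Iff_refl.
  - rewrite !h; apply Iff_refl.
  - destruct (IHp _ _ _ _ h) as [f g];
    apply Iff_intro; intros u x; [exact (u (g x)) | exact (u (f x))].
  - destruct (IHp _ _ _ _ h) as [f g], (IHq _ _ _ _ h) as [f' g'].
    apply Iff_intro; intros u x; auto.
  - destruct (IHp _ _ _ _ h) as [f g], (IHq _ _ _ _ h) as [f' g'].
    apply Iff_intro; intros [x y]; apply both; auto.
  - destruct (IHp _ _ _ _ h) as [f g], (IHq _ _ _ _ h) as [f' g'].
    apply Iff_intro; refine (Or_elim _ _); intro x; apply tr.
    + exact (inl _ (f x)).
    + exact (inr _ (f' x)).
    + exact (inl _ (g x)).
    + exact (inr _ (g' x)).
  - assert (e : forall x, Iff (interp (rename p (up s)) (push x t)) (interp p (push x t'))).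
    { intro x; apply IHp, lookup_scons; [reflexivity | exact h]. }
    apply Iff_intro; refine (Exists_elim _); intros x u; apply (Exists_intro (a := x)).
    + exact (projT1 (e x) u).
    + exact (projT2 (e x) u).
  - assert (e : forall x, Iff (interp (rename p (up s)) (push x t)) (interp p (push x t'))).
    { intro x; apply IHp, lookup_scons; [reflexivity | exact h]. }
    apply Iff_intro; intros u x.
    + exact (projT1 (e x) (u x)).
    + exact (projT2 (e x) (u x)).
Qed.

#[export] Instance Large_interp n (p : formula n) (t : power V n) : Large (interp p t).
Proof. apply In_interp. Defined.

#[export] Instance Irrelevant_interp n (p : formula n) (t : power V n) : Irrelevant (interp p t).
Proof. intros x y; apply isProp_interp. Defined.

(** Closes the hypothesis of [interp_rename], one variable of the schematic formula at a
    time. *)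
Ltac solve_lookup := repeat (apply lookup_scons; [reflexivity|]); reflexivity.

(** * The axioms *)

Lemma models_Extensionality : models V Extensionality.
Proof. intros t a b h; exact (extensionality h). Qed.

Lemma models_EmptySet : models V EmptySet.
Proof.
  intro t; destruct Coll_empty as [w hw].
  apply (Exists_intro (a := w)); intro x; exact (projT1 (hw x)).
Qed.

Lemma models_Pairing : models V Pairing.
Proof.
  intros t a b; destruct (Coll_pair a b) as [w hw]; exact (Exists_intro (a := w) hw).
Qed.

Lemma models_Union : models V Union.
Proof.
  intros t a; destruct (Coll_union a (fun y => y)) as [w hw]; exact (Exists_intro (a := w) hw).
Qed.

Lemma models_StrongInfinity : models V StrongInfinity.
Proof.
  intro t; apply (Exists_intro (a := omega)), both; [exact IsInductive_omega | exact omega_least].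
Qed.

Lemma models_Infinity : models V Infinity.
Proof. intro t; exact (Exists_intro (a := omega) IsInductive_omega). Qed.

Lemma models_Powerset : models V Powerset.
Proof.
  intros t a; destruct (Coll_subset a) as [w hw]; exact (Exists_intro (a := w) hw).
Qed.

Lemma models_Separation n (phi : formula (2 + n)) : models V (Separation phi).
Proof.
  intros t a.
  destruct (Coll_separation a (phi := fun x => interp phi (push x (push a t)))) as [w hw].
  apply (Exists_intro (a := w)); intro x.
  assert (r := interp_rename phi (s := scons v0 (scons v2 (fun i => FS (FS (FS i)))))
    (t := push x (push w (push a t))) (t' := push x (push a t)) ltac:(solve_lookup)).
  apply Iff_intro; intro h.
  - destruct (projT1 (hw x) h) as [k l]; exact (both k (projT2 r l)).
  - destruct h as [k l]; exact (projT2 (hw x) (both k (projT1 r l))).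
Qed.

Lemma models_EpsInduction n (phi : formula (1 + n)) : models V (EpsInduction phi).
Proof.
  intros t h; refine (eps_induction _); intros a IH; apply (h a); intros y hy.
  refine (projT2 (interp_rename phi (t' := push y t) _) (IH y hy)); solve_lookup.
Qed.

Lemma models_StrongCollection n (phi : formula (3 + n)) : models V (StrongCollection phi).
Proof.
  intros t a h.
  pose (P := fun x y => interp phi (push x (push y (push a t)))).
  assert (k : forall x, mem x a -> Exists (fun y => P x y)).
  { intros x hx; generalize (h x hx); refine (Exists_elim _); intros y l.
    apply (Exists_intro (a := y)); refine (projT1 (interp_rename phi _) l); solve_lookup. }
  generalize (strong_collection k); refine (Exists_elim _); intros b [u v].
  apply (Exists_intro (a := b)), both.
  - intros x hx; generalize (u x hx); refine (Exists_elim _); intros y [hy l].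
    refine (Exists_intro (a := y) (both hy _)).
    refine (projT2 (interp_rename phi _) l); solve_lookup.
  - intros y hy; generalize (v y hy); refine (Exists_elim _); intros x [hx l].
    refine (Exists_intro (a := x) (both hx _)).
    refine (projT2 (interp_rename phi _) l); solve_lookup.
Qed.

Lemma models_Collection n (theta : formula (3 + n)) : models V (Collection theta).
Proof.
  intros t a h; generalize (models_StrongCollection h); refine (Exists_elim _).
  intros b [u _]; exact (Exists_intro (a := b) u).
Qed.

(** Every image of [a] inside [b] is a subset of [b], so the power set of [b] contains
    the required [d] for all values of the parameter [u]. *)
Lemma models_SubsetCollection n (psi : formula (5 + n)) : models V (SubsetCollection psi).
Proof.
  intros t a b; destruct (Coll_subset b) as [c hc]; apply (Exists_intro (a := c)); intros u h.
  pose (P := fun x y => interp psi (push x (push y (push u (push a (push b t)))))).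
  destruct (Coll_separation b (phi := fun y => Exists (fun x => Times (mem x a) (P x y))))
    as [d hd].
  apply (Exists_intro (a := d)), both; [|apply both].
  - apply (projT2 (hc d)); intros y hy; exact (projT1 (projT1 (hd y) hy)).
  - intros x hx; generalize (h x hx); refine (Exists_elim _); intros y [hy k].
    assert (l : P x y) by (refine (projT1 (interp_rename psi _) k); solve_lookup).
    apply (Exists_intro (a := y)), both.
    + exact (projT2 (hd y) (both hy (Exists_intro (a := x) (both hx l)))).
    + refine (projT2 (interp_rename psi _) l); solve_lookup.
  - intros y hy; generalize (projT2 (projT1 (hd y) hy)); refine (Exists_elim _); intros x [hx l].
    refine (Exists_intro (a := x) (both hx _)).
    refine (projT2 (interp_rename psi _) l); solve_lookup.
Qed.

End Model.

Theorem corollary4 (H : HoTT) (V : CumulativeHierarchy H)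
    (lem : LEM (U H)) (lem' : LEM (U' H))
    (n : nat) (chi : formula n) :
  (CZF chi + IZF chi)%type -> models V chi.
Proof.
  intros [h|h]; destruct h.
  - apply models_Extensionality.
  - apply models_EmptySet; assumption.
  - apply models_Pairing; assumption.
  - apply models_Union; assumption.
  - apply models_StrongInfinity; assumption.
  - apply models_Separation; assumption.
  - apply models_EpsInduction; assumption.
  - apply models_StrongCollection; assumption.
  - apply models_SubsetCollection; assumption.
  - apply models_Extensionality.
  - apply models_EmptySet; assumption.
  - apply models_Pairing; assumption.
  - apply models_Union; assumption.
  - apply models_Infinity; assumption.
  - apply models_Powerset; assumption.
  - apply models_Separation; assumption.
  - apply models_EpsInduction; assumption.
  - apply models_Collection; assumption.
Qed.
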